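(* Let $ABCD$ be a convex quadrilateral such that $$AB \cap CD = \{E\},\quad BC \cap AD = \{F\},\quad BD \cap EF = \{P\},\quad AC \cap EF = \{R\},\quad AC \cap BD = \{O\}.$$ Let $G, H, I, J, K, L, M, N, Q, U, V, T$ be respectively the midpoints of the segments $(AB), (BF), (AF), (AD), (AE), (DE), (CE), (BE), (BC), (CF), (DF), (DC)$. Then: i) The triangle $POR$ is homological with each of the triangles $GHI$, $JKL$, $MNQ$, $UVT$. ii) The triangles $GHI$ and $JKL$ are homological. iii) The triangles $MNQ$ and $UVT$ are homological. iv) The homology centers of the triangles $GHI$, $JKL$, $POR$ (taken two by two) are collinear. v) The homology centers of the triangles $MNQ$, $UVT$, $POR$ (taken two by two) are collinear.
   Context: For points $X\neq Y$ in the plane, $XY$ denotes the line through $X$ and $Y$ when intersections are taken, and $(XY)$ the segment with endpoints $X$ and $Y$. Two triangles $X_1X_2X_3$ and $Y_1Y_2Y_3$, with vertices corresponding as $X_i\leftrightarrow Y_i$, are called homological if the lines $X_1Y_1$, $X_2Y_2$, $X_3Y_3$ are concurrent, i.e. pass through a common point; that point is called the homology center of the two triangles. The vertices of the triangles above correspond as follows: the vertices $P, O, R$ of $POR$ correspond respectively to $H, G, I$ in $GHI$, to $L, J, K$ in $JKL$, to $N, Q, M$ in $MNQ$, and to $V, T, U$ in $UVT$; the vertices $G, H, I$ correspond respectively to $J, L, K$; the vertices $M, N, Q$ correspond respectively to $U, V, T$.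
   Formalization: In i), iv) and v) the homology center may be a point at infinity (three parallel lines): with A(-4,6), B(-1,6), C(5,0), D(-1,-2) the lines joining POR to MNQ are parallel, so i) fails with an ordinary common point. *)

(* Defs.v *)
From mathcomp Require Import all_boot all_order all_algebra.

Set Implicit Arguments.
Unset Strict Implicit.
Unset Printing Implicit Defensive.

Import Order.TTheory GRing.Theory Num.Theory.
Local Open Scope ring_scope.

(* The plane is 'rV_2.  A point of its projective completion is a nonzero     *)
(* vector of 'rV_3 up to scaling; (a, b, 0) is the point at infinity of the   *)
(* lines with direction (a, b).                                               *)
Definition hpt (k : realFieldType) (X : 'rV[k]_2) : 'rV[k]_3 :=
  row_mx X 1%:M.

Definition hdet (k : realFieldType) (p q r : 'rV[k]_3) : k :=
  \det (col_mx p (col_mx q r) : 'M[k]_3).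

Definition collinear (k : realFieldType) (p q r : 'rV[k]_3) : bool :=
  hdet p q r == 0.

(* Twice the signed area of the triangle XYZ. *)
Definition orient (k : realFieldType) (X Y Z : 'rV[k]_2) : k :=
  hdet (hpt X) (hpt Y) (hpt Z).

(* p lies on the line XY (meaningful only for X != Y). *)
Definition on_line (k : realFieldType) (X Y : 'rV[k]_2) (p : 'rV[k]_3) : bool :=
  collinear (hpt X) (hpt Y) p.

(* XY meets ZW, in the plane, exactly in {S}; this forces X != Y, Z != W and  *)
(* XY, ZW to be distinct and not parallel.                                    *)
Definition meet_at (k : realFieldType) (X Y Z W S : 'rV[k]_2) : Prop :=
  forall p : 'rV[k]_2, on_line X Y (hpt p) && on_line Z W (hpt p) = (p == S).

(* Z and W lie strictly on the same side of the line XY. *)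
Definition same_side (k : realFieldType) (X Y Z W : 'rV[k]_2) : bool :=
  0 < orient X Y Z * orient X Y W.

Definition convex_quadrilateral (k : realFieldType) (A B C D : 'rV[k]_2) : bool :=
  [&& same_side A B C D, same_side B C D A, same_side C D A B
    & same_side D A B C].

Definition midpoint (k : realFieldType) (X Y : 'rV[k]_2) : 'rV[k]_2 :=
  2^-1 *: (X + Y).

Definition triangle (k : realFieldType) : Type :=
  ('rV[k]_2 * 'rV[k]_2 * 'rV[k]_2)%type.

Definition nondegenerate (k : realFieldType) (T : triangle k) : bool :=
  let: (X1, X2, X3) := T in orient X1 X2 X3 != 0.

(* The vertices correspond in the order in which they are listed.             *)
(* Concurrency is understood in the projective completion: the center p may   *)
(* be at infinity, i.e. the three lines may be parallel.  If they are not all *)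
(* parallel, p is necessarily an ordinary point.                              *)
Definition homology_center (k : realFieldType) (T1 T2 : triangle k)
    (p : 'rV[k]_3) : Prop :=
  let: (X1, X2, X3) := T1 in
  let: (Y1, Y2, Y3) := T2 in
  [/\ nondegenerate T1 /\ nondegenerate T2,
      [/\ X1 != Y1, X2 != Y2 & X3 != Y3],
      p != 0
    & [/\ on_line X1 Y1 p, on_line X2 Y2 p & on_line X3 Y3 p]].

Definition homological (k : realFieldType) (T1 T2 : triangle k) : Prop :=
  exists p : 'rV[k]_3, homology_center T1 T2 p.

(* Homological with a center in the plane itself. *)
Definition affinely_homological (k : realFieldType) (T1 T2 : triangle k) : Prop :=
  exists S : 'rV[k]_2, homology_center T1 T2 (hpt S).

(* Main.v *)
Require Import Defs.
From mathcomp Require Import all_boot all_order all_algebra.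
From mathcomp Require Import ring.

Set Implicit Arguments.
Unset Strict Implicit.
Unset Printing Implicit Defensive.

Import Order.TTheory GRing.Theory Num.Theory.
Local Open Scope ring_scope.

(** Write the dependency between the four vertices as
      al A + ga C = be B + de D,   al + ga = be + de,
    in homogeneous coordinates; convexity makes the four weights nonzero
    (quadrilateral_weighted).  The diagonal points are then
      E = al A - be B,   F = al A - de D,   O = al A + ga C,
      P = be B - de D,   R = al A - ga C
    up to scaling, and the scaling factors are nonzero because the points are
    ordinary.  The vector
      q = 4 al be G - (al + ga)^2 O
        = 4 be (al - de) H - (be - de)^2 P
        = 4 al (al - de) I - (al - ga)^2 R
    is therefore on OG, PH and RI: it is the homology center of POR and HGI
    (homology_center_diag).  Exchanging B and D exchanges E and F, and turns
    HGI into LJK and q into r = 4 al de J - (al + ga)^2 O.  Now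
      q - r = 4 al be G - 4 al de J = 4 al (be - de) S,   S = mid(A, P),
    and the same difference is a combination of H and L, and of I and K; so S is
    the homology center of GHI and JLK (homology_center_mid), and it is aligned
    with q and r.  Centers are unique up to scaling (homology_center_uniq), so
    this settles every choice of centers (centers_collinear).  Exchanging A and
    C exchanges E and F, and carries the four results about GHI and JLK to QNM
    and TVU.

    Incidences and nondegeneracy are verified in barycentric coordinates over
    the triangle ABD, where they become identities between rational functions
    of the weights. *)

(** * Coordinates in the projective plane *)

Lemma hdetE (k : realFieldType) (p q r : 'rV[k]_3) :
  hdet p q r =
    p 0 0 * (q 0 1 * r 0 2%:R - q 0 2%:R * r 0 1)
    - p 0 1 * (q 0 0 * r 0 2%:R - q 0 2%:R * r 0 0)
    + p 0 2%:R * (q 0 0 * r 0 1 - q 0 1 * r 0 0).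
Proof.
rewrite /hdet; set m : 'M[k]_3 := col_mx p _.
have i0 : (0 : 'I_3) = lshift 2 (0 : 'I_1) by apply: val_inj.
have i1 : (1 : 'I_3) = rshift 1 (lshift 1 (0 : 'I_1)) by apply: val_inj.
have i2 : (2%:R : 'I_3) = rshift 1 (rshift 1 (0 : 'I_1)) by apply: val_inj.
have m0 j : m 0 j = p 0 j.
  by rewrite i0; exact: (col_mxEu p (col_mx q r) 0 j).
have m1 j : m 1 j = q 0 j.
  by rewrite i1 -(col_mxEu q r 0 j); exact: (col_mxEd p (col_mx q r) _ j).
have m2 j : m 2%:R j = r 0 j.
  by rewrite i2 -(col_mxEd q r 0 j); exact: (col_mxEd p (col_mx q r) _ j).
clearbody m.
have l1 : lift (0 : 'I_3) (0 : 'I_2) = 1 by apply: val_inj.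
have l2 : lift (0 : 'I_3) (1 : 'I_2) = 2%:R by apply: val_inj.
have l10 : lift (1 : 'I_3) (0 : 'I_2) = 0 by apply: val_inj.
have l12 : lift (1 : 'I_3) (1 : 'I_2) = 2%:R by apply: val_inj.
have l20 : lift (2%:R : 'I_3) (0 : 'I_2) = 0 by apply: val_inj.
have l21 : lift (2%:R : 'I_3) (1 : 'I_2) = 1 by apply: val_inj.
have l0 n : ord0 = 0 :> 'I_n.+1 by apply: val_inj.
have det2 (N : 'M[k]_2) : \det N = N 0 0 * N 1 1 - N 0 1 * N 1 0.
  rewrite (expand_det_row _ 0) !big_ord_recl big_ord0 /cofactor !det_mx11 !mxE.
  have e1 : lift (0 : 'I_2) (0 : 'I_1) = 1 by apply: val_inj.
  have e2 : lift (1 : 'I_2) (0 : 'I_1) = 0 by apply: val_inj.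
  by rewrite !l0 e1 e2 /=; ring.
rewrite (expand_det_row _ 0) !big_ord_recl big_ord0 /cofactor.
have l3 : lift (0 : 'I_3) (lift (0 : 'I_2) (0 : 'I_1)) = 2%:R.
  exact: val_inj.
rewrite !l0 l3 !l1.
rewrite !det2 !mxE !l1 !l2 !l10 !l12 !l20 !l21 !m0 !m1 !m2 /=.
by ring.
Qed.

Lemma hptE (k : realFieldType) (X : 'rV[k]_2) :
  (hpt X 0 0 = X 0 0) * (hpt X 0 1 = X 0 1) * (hpt X 0 2%:R = 1).
Proof.
have h0 : (0 : 'I_3) = lshift 1 (0 : 'I_2) by apply: val_inj.
have h1 : (1 : 'I_3) = lshift 1 (1 : 'I_2) by apply: val_inj.
have h2 : (2%:R : 'I_3) = rshift 2 (0 : 'I_1) by apply: val_inj.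
split; [split|]; first by rewrite h0; exact: (row_mxEl X 1%:M 0 0).
- by rewrite h1; exact: (row_mxEl X 1%:M 0 1).
- by rewrite h2; apply: etrans (row_mxEr X 1%:M 0 0) _; rewrite mxE.
Qed.

Lemma rV3P (k : realFieldType) (p q : 'rV[k]_3) :
  p 0 0 = q 0 0 -> p 0 1 = q 0 1 -> p 0 2%:R = q 0 2%:R -> p = q.
Proof.
move=> e0 e1 e2; apply/rowP => -[[|[|[|i]]] lti] //.
- by rewrite (_ : Ordinal lti = 0) //; apply: val_inj.
- by rewrite (_ : Ordinal lti = 1) //; apply: val_inj.
- by rewrite (_ : Ordinal lti = 2%:R) //; apply: val_inj.
Qed.

Lemma hpt_inj (k : realFieldType) : injective (@hpt k).
Proof.
move=> X Y eXY.
by case: (eq_row_mx (eXY : row_mx X 1%:M = row_mx Y 1%:M)).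
Qed.

Lemma hptP (k : realFieldType) (p : 'rV[k]_3) :
  p 0 2%:R = 1 -> exists X, hpt X = p.
Proof.
move=> p2; exists (\row_(i < 2) if i == 0 then p 0 0 else p 0 1).
by apply: rV3P; rewrite !hptE ?p2 // mxE.
Qed.

Lemma lincombE (k : realFieldType) (p q : 'rV[k]_3) (x y : k) (j : 'I_3) :
  (x *: p + y *: q) 0 j = x * p 0 j + y * q 0 j.
Proof. by rewrite !mxE. Qed.

Lemma hpt_midpoint (k : realFieldType) (X Y : 'rV[k]_2) :
  hpt (midpoint X Y) = 2^-1 *: hpt X + 2^-1 *: hpt Y.
Proof. by apply: rV3P; rewrite lincombE !hptE ?mxE; field. Qed.

Lemma hdet_lin (k : realFieldType) (u v p q : 'rV[k]_3) (x y : k) :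
  hdet u v (x *: p + y *: q) = x * hdet u v p + y * hdet u v q.
Proof. by rewrite !hdetE !mxE; ring. Qed.

Lemma hdet_alt (k : realFieldType) (u v : 'rV[k]_3) :
  (hdet u v u = 0) * (hdet u v v = 0) * (hdet u u v = 0).
Proof. by rewrite !hdetE; split; [split|]; ring. Qed.

Lemma hdet_rot (k : realFieldType) (u v w : 'rV[k]_3) :
  hdet u v w = hdet v w u.
Proof. by rewrite !hdetE; ring. Qed.

Lemma orient_neq (k : realFieldType) (X Y Z : 'rV[k]_2) :
  orient X Y Z != 0 -> [/\ X != Y, Y != Z & X != Z].
Proof.
rewrite /orient => XYZ.
by split; apply: contraNneq XYZ => eXY; rewrite eXY ?hdet_alt //.
Qed.

(** Two vertices are told apart below by exhibiting a line through one of them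
    that misses the other. *)
Lemma neq_on_line (k : realFieldType) (X Y Z W : 'rV[k]_2) :
  on_line Z W (hpt X) -> ~~ on_line Z W (hpt Y) -> X != Y.
Proof. by move=> ZWX; apply: contraNneq => <-. Qed.

(** * Uniqueness of the homology center *)

(** In the projective plane X, p and q are on the line XY, hence dependent.  The
    identity used is the Pluecker relation in the quotient by X, and some v
    has hdet X Y v != 0 because X and Y are distinct points. *)
Lemma hdet_on_line (k : realFieldType) (X Y : 'rV[k]_2) (p q : 'rV[k]_3) :
  X != Y -> on_line X Y p -> on_line X Y q -> hdet (hpt X) p q = 0.
Proof.
move=> neXY /eqP pXY /eqP qXY; apply: contraNeq neXY => Xpq.
have XY0 v : hdet (hpt X) (hpt Y) v = 0.
  apply/(mulfI Xpq); rewrite mulr0.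
  transitivity (hdet (hpt X) (hpt Y) q * hdet (hpt X) p v
                - hdet (hpt X) (hpt Y) p * hdet (hpt X) q v).
    by rewrite !hdetE; ring.
  by rewrite pXY qXY; ring.
have := XY0 (delta_mx 0 1); have := XY0 (delta_mx 0 0).
rewrite !hdetE !hptE.
have d00 j : (delta_mx 0 0 : 'rV[k]_3) 0 j = (j == 0)%:R by rewrite mxE.
have d01 j : (delta_mx 0 1 : 'rV[k]_3) 0 j = (j == 1)%:R by rewrite mxE.
rewrite !d00 !d01 /= => e0 e1.
apply/eqP/hpt_inj/rV3P; rewrite !hptE //.
  by apply/eqP; rewrite -subr_eq0 -oppr_eq0 -e1; apply/eqP; ring.
by apply/eqP; rewrite -subr_eq0 -e0; apply/eqP; ring.
Qed.

(** If p and q were different points, every X_i would lie on the line pq,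
    against the nondegeneracy of the first triangle.  So hdet v p q vanishes for
    the three X_i, hence for all v (Cramer), and p is a multiple of q. *)
Lemma homology_center_uniq (k : realFieldType) (T1 T2 : triangle k)
    (p q : 'rV[k]_3) :
  homology_center T1 T2 p -> homology_center T1 T2 q -> exists c, p = c *: q.
Proof.
case: T1 T2 => [[X1 X2] X3] [[Y1 Y2] Y3].
move=> [[/= T1 _] [n1 n2 n3] _ [p1 p2 p3]] [_ _ q0 [q1 q2 q3]].
have h1 := hdet_on_line n1 p1 q1.
have h2 := hdet_on_line n2 p2 q2.
have h3 := hdet_on_line n3 p3 q3.
have hv v : hdet v p q = 0.
  apply/(mulfI T1); rewrite mulr0 /orient.
  transitivity (hdet (hpt X1) p q * hdet v (hpt X2) (hpt X3)
    + hdet (hpt X2) p q * hdet (hpt X1) v (hpt X3)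
    + hdet (hpt X3) p q * hdet (hpt X1) (hpt X2) v).
    by rewrite !hdetE; ring.
  by rewrite h1 h2 h3; ring.
have d j i : (delta_mx 0 j : 'rV[k]_3) 0 i = (i == j)%:R by rewrite mxE.
have e0 := hv (delta_mx 0 0); rewrite hdetE !d /= in e0.
have e1 := hv (delta_mx 0 1); rewrite hdetE !d /= in e1.
have e2 := hv (delta_mx 0 2%:R); rewrite hdetE !d /= in e2.
have {}e0 : p 0 1 * q 0 2%:R = p 0 2%:R * q 0 1.
  by apply/eqP; rewrite -subr_eq0 -e0; apply/eqP; ring.
have {}e1 : p 0 0 * q 0 2%:R = p 0 2%:R * q 0 0.
  by apply/eqP; rewrite -subr_eq0 -oppr_eq0 -e1; apply/eqP; ring.
have {}e2 : p 0 0 * q 0 1 = p 0 1 * q 0 0.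
  by apply/eqP; rewrite -subr_eq0 -e2; apply/eqP; ring.
have [c0|c0] := eqVneq (q 0 0) 0; last first.
  by exists (p 0 0 / q 0 0); apply: rV3P; rewrite mxE mulrAC ?e1 ?e2 mulfK.
have [c1|c1] := eqVneq (q 0 1) 0; last first.
  by exists (p 0 1 / q 0 1); apply: rV3P; rewrite mxE mulrAC -?e2 ?e0 mulfK.
have [c2|c2] := eqVneq (q 0 2%:R) 0; last first.
  exists (p 0 2%:R / q 0 2%:R).
  by apply: rV3P; rewrite mxE mulrAC -?e1 -?e0 mulfK.
by case/eqP: q0; apply: rV3P; rewrite ?c0 ?c1 ?c2 mxE.
Qed.

Lemma homology_center_rev (k : realFieldType) (X1 X2 X3 Y1 Y2 Y3 : 'rV[k]_2)
    (p : 'rV[k]_3) :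
  homology_center (X1, X2, X3) (Y1, Y2, Y3) p ->
  homology_center (X3, X2, X1) (Y3, Y2, Y1) p.
Proof.
have rev (X Y Z : 'rV[k]_2) : orient Z Y X = - orient X Y Z.
  by rewrite /orient !hdetE; ring.
case=> [[n1 n2] [? ? ?] ? [? ? ?]]; split=> //.
by split; rewrite /nondegenerate /= rev oppr_eq0.
Qed.

(** * Barycentric coordinates *)

(** Homogeneous barycentric coordinates: the three vectors need not be
    normalized, nor the coordinates sum to 1. *)
Definition bary (k : realFieldType) (a b d : 'rV[k]_3) (x y z : k) :=
  x *: a + y *: b + z *: d.

Lemma hdet_bary (k : realFieldType) (a b d : 'rV[k]_3)
    (x1 y1 z1 x2 y2 z2 x3 y3 z3 : k) :
  hdet (bary a b d x1 y1 z1) (bary a b d x2 y2 z2) (bary a b d x3 y3 z3) =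
  (x1 * (y2 * z3 - z2 * y3) - y1 * (x2 * z3 - z2 * x3)
    + z1 * (x2 * y3 - y2 * x3)) * hdet a b d.
Proof. by rewrite !hdetE !mxE; ring. Qed.

Lemma baryC (k : realFieldType) (a b d : 'rV[k]_3) (x y z : k) :
  bary a d b x y z = bary a b d x z y.
Proof. by rewrite /bary -!addrA [y *: d + _]addrC. Qed.

Lemma bary_lin (k : realFieldType) (a b d : 'rV[k]_3)
    (x y x1 y1 z1 x2 y2 z2 : k) :
  x *: bary a b d x1 y1 z1 + y *: bary a b d x2 y2 z2 =
  bary a b d (x * x1 + y * x2) (x * y1 + y * y2) (x * z1 + y * z2).
Proof. by apply: rV3P; rewrite !mxE; ring. Qed.

Lemma baryE (k : realFieldType) (a b d : 'rV[k]_3) :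
  (a = bary a b d 1 0 0) * (b = bary a b d 0 1 0) * (d = bary a b d 0 0 1).
Proof. by split; [split|]; apply: rV3P; rewrite !mxE; ring. Qed.

Lemma hdet_bary_neq0 (k : realFieldType) (a b d : 'rV[k]_3)
    (c x1 y1 z1 x2 y2 z2 x3 y3 z3 : k) :
  hdet a b d != 0 ->
  x1 * (y2 * z3 - z2 * y3) - y1 * (x2 * z3 - z2 * x3)
    + z1 * (x2 * y3 - y2 * x3) = c ->
  c != 0 ->
  hdet (bary a b d x1 y1 z1) (bary a b d x2 y2 z2) (bary a b d x3 y3 z3) != 0.
Proof. by move=> abd0 ec c0; rewrite hdet_bary ec mulf_neq0. Qed.

Lemma hdet_bary_eq0 (k : realFieldType) (a b d : 'rV[k]_3)
    (x1 y1 z1 x2 y2 z2 x3 y3 z3 : k) :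
  x1 * (y2 * z3 - z2 * y3) - y1 * (x2 * z3 - z2 * x3)
    + z1 * (x2 * y3 - y2 * x3) = 0 ->
  hdet (bary a b d x1 y1 z1) (bary a b d x2 y2 z2) (bary a b d x3 y3 z3) == 0.
Proof. by move=> e0; rewrite hdet_bary e0 mul0r. Qed.

(** * Weights on a convex quadrilateral *)

(** A dependency x X + y Y = z Z + w W between points of two lines exhibits
    their common point in homogeneous form.  If it were at infinity (x + y = 0),
    then adding it to S would give a second common point, unless it is zero, which
    x != 0 and X != Y forbid. *)
Lemma meet_bary (k : realFieldType) (X Y Z W S : 'rV[k]_2) (x y z w : k) :
  meet_at X Y Z W S -> X != Y -> x != 0 ->
  x *: hpt X + y *: hpt Y = z *: hpt Z + w *: hpt W ->
  x + y != 0 /\ (x + y) *: hpt S = x *: hpt X + y *: hpt Y.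
Proof.
move=> meetS neXY nz_x; set v := _ + _ => ev.
have v2 : v 0 2%:R = x + y by rewrite lincombE !hptE; ring.
have vXY : hdet (hpt X) (hpt Y) v = 0 by rewrite hdet_lin !hdet_alt; ring.
have vZW : hdet (hpt Z) (hpt W) v = 0 by rewrite ev hdet_lin !hdet_alt; ring.
have onS p : hdet (hpt X) (hpt Y) (hpt p) = 0 ->
    hdet (hpt Z) (hpt W) (hpt p) = 0 -> p = S.
  move=> pXY pZW; apply/eqP; rewrite -meetS.
  by rewrite /on_line /collinear pXY pZW eqxx.
have [sXY sZW] : hdet (hpt X) (hpt Y) (hpt S) = 0 /\
                 hdet (hpt Z) (hpt W) (hpt S) = 0.
  by have:= meetS S; rewrite eqxx => /andP[/eqP ? /eqP ?].
have nz_xy : x + y != 0.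
  apply: contra neXY => /eqP xy0.
  have [p ep] : exists p, hpt p = 1 *: hpt S + 1 *: v.
    by apply: hptP; rewrite lincombE hptE v2 xy0; ring.
  have eS : p = S.
    by apply: onS; rewrite ep hdet_lin ?sXY ?vXY ?sZW ?vZW; ring.
  have v0 : v = 0.
    by move: ep; rewrite eS !scale1r -[LHS]addr0 => /addrI.
  apply/eqP/hpt_inj/(scalerI nz_x)/eqP; rewrite -subr_eq0 -scaleNr.
  have -> : - x = y by apply/esym/eqP; rewrite -addr_eq0 addrC xy0.
  by rewrite -[X in X == 0]/v v0.
split=> //; have [p ep] : exists p, hpt p = (x + y)^-1 *: v + 0 *: v.
  by apply: hptP; rewrite lincombE v2 mulVf // mul0r addr0.
have <- : p = S by apply: onS; rewrite ep hdet_lin ?vXY ?vZW; ring.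
by rewrite ep scale0r addr0 scalerA divff // scale1r.
Qed.

(** The points A, B, C, D, taken with weights al, be, ga, de such that
    al A + ga C = be B + de D as vectors of the projective completion.  The five
    intersection points are the sums and differences of the weighted vertices,
    and the configuration keeps this shape under the two swaps below. *)
Record weighted (k : realFieldType) (A B C D E F P R O : 'rV[k]_2)
    (al be ga de : k) : Prop := Weighted {
  weights_neq0 : [/\ al != 0, be != 0, ga != 0 & de != 0];
  ABD_neq0 : orient A B D != 0;
  weightsE : al + ga = be + de;
  diagonalsE : al *: hpt A + ga *: hpt C = be *: hpt B + de *: hpt D;
  meetE : al - be != 0 /\
    (al - be) *: hpt E = al *: hpt A + (- be) *: hpt B;
  meetF : al - de != 0 /\
    (al - de) *: hpt F = al *: hpt A + (- de) *: hpt D;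
  meetP : be - de != 0 /\
    (be - de) *: hpt P = be *: hpt B + (- de) *: hpt D;
  meetR : al - ga != 0 /\
    (al - ga) *: hpt R = al *: hpt A + (- ga) *: hpt C;
  meetO : al + ga != 0 /\
    (al + ga) *: hpt O = al *: hpt A + ga *: hpt C }.

(** The weights are the minors in the linear dependency between the four
    vectors hpt A, hpt B, hpt C, hpt D of a 3-dimensional space; convexity
    makes all of them nonzero.  E, F and O are obtained by grouping the terms of
    the dependency; P and R by subtracting or adding the expressions found for
    E and F. *)
Lemma quadrilateral_weighted (k : realFieldType)
    (A B C D E F P R O : 'rV[k]_2) :
  convex_quadrilateral A B C D ->
  meet_at A B C D E -> meet_at B C A D F ->
  meet_at B D E F P -> meet_at A C E F R -> meet_at A C B D O ->
  weighted A B C D E F P R O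
    (orient B C D) (orient C D A) (orient D A B) (orient A B C).
Proof.
have ss (X Y Z W : 'rV[k]_2) : same_side X Y Z W ->
    orient X Y Z != 0 /\ orient X Y W != 0.
  by move=> /lt0r_neq0; rewrite mulf_eq0 negb_or => /andP[].
case/and4P=> /ss[de0 ABD] /ss[al0 _] /ss[be0 _] /ss[ga0 _] hE hF hP hR hO.
have [AB BC AC] := orient_neq de0.
have [_ BD _] := orient_neq ABD.
have wE : orient B C D + orient D A B = orient C D A + orient A B C.
  by rewrite /orient !hdetE !hptE; ring.
have dg : orient B C D *: hpt A + orient D A B *: hpt C =
          orient C D A *: hpt B + orient A B C *: hpt D.
  by apply: rV3P; rewrite !lincombE /orient !hdetE !hptE; ring.
move: (orient B C D) (orient C D A) (orient D A B) (orient A B C)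
  al0 be0 ga0 de0 wE dg => al be ga de al0 be0 ga0 de0 wE dg.
have eC : ga *: hpt C = be *: hpt B + de *: hpt D - al *: hpt A.
  by rewrite -dg [RHS]addrC addKr.
have wF : be - ga = al - de by rewrite -[ga](addKr al) wE; ring.
have [abe eE] : al + - be != 0 /\
    (al + - be) *: hpt E = al *: hpt A + (- be) *: hpt B.
  apply: meet_bary hE AB al0 (_ : _ = (- ga) *: hpt C + de *: hpt D).
  rewrite [(- ga) *: _]scaleNr eC; move: (hpt A) (hpt B) (hpt D) => a b d.
  by apply: rV3P; rewrite !mxE; ring.
have eFd : be *: hpt B + (- ga) *: hpt C = al *: hpt A + (- de) *: hpt D.
  rewrite [(- ga) *: _]scaleNr eC; move: (hpt A) (hpt B) (hpt D) => a b d.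
  by apply: rV3P; rewrite !mxE; ring.
have [ade eF] : be + - ga != 0 /\
    (be + - ga) *: hpt F = be *: hpt B + (- ga) *: hpt C.
  exact: meet_bary hF BC be0 eFd.
rewrite wF in ade eF; rewrite eFd in eF.
have eP : be + - de != 0 /\
    (be + - de) *: hpt P = be *: hpt B + (- de) *: hpt D.
  apply: meet_bary hP BD be0
    (_ : _ = (- (al - be)) *: hpt E + (al - de) *: hpt F).
  rewrite eF [(- (al - be)) *: _]scaleNr eE.
  move: (hpt A) (hpt B) (hpt D) => a b d.
  by apply: rV3P; rewrite !mxE; ring.
have eR : al + - ga != 0 /\
    (al + - ga) *: hpt R = al *: hpt A + (- ga) *: hpt C.
  apply: meet_bary hR AC al0 (_ : _ = (al - be) *: hpt E + (al - de) *: hpt F).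
  rewrite eF eE [(- ga) *: _]scaleNr eC.
  move: (hpt A) (hpt B) (hpt D) => a b d.
  by apply: rV3P; rewrite !mxE; ring.
have eO := meet_bary hO AC al0 dg.
by split.
Qed.

(** Exchanging B and D exchanges E and F, hence the triangle GHI with JLK. *)
Lemma weighted_swapBD (k : realFieldType) (A B C D E F P R O : 'rV[k]_2)
    (al be ga de : k) :
  weighted A B C D E F P R O al be ga de ->
  weighted A D C B F E P R O al de ga be.
Proof.
case=> [[? ? ? ?] ABD ? dg ? ? [bd eP] ? ?]; split=> //.
- apply: contraNneq ABD => ADB; rewrite -oppr_eq0 -ADB /orient !hdetE.
  by apply/eqP; ring.
- by rewrite [RHS]addrC.
- by rewrite dg addrC.
- split; first by rewrite -opprB oppr_eq0.
  by rewrite -opprB scaleNr eP opprD addrC -!scaleNr opprK.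
Qed.

(** Exchanging A and C exchanges E and F, hence the triangle GHI with QNM and
    JLK with TVU. *)
Lemma weighted_swapAC (k : realFieldType) (A B C D E F P R O : 'rV[k]_2)
    (al be ga de : k) :
  weighted A B C D E F P R O al be ga de ->
  weighted C B A D F E P R O ga be al de.
Proof.
case=> [[al0 ? ga0 ?] ABD wE dg [abe eE] [ade eF] [bd eP] [ag eR] [o eO]].
have fa : ga - be = - (al - de) by rewrite -[ga](addKr al) wE; ring.
have fe : ga - de = - (al - be) by rewrite -[ga](addKr al) wE; ring.
have eC : ga *: hpt C = be *: hpt B + de *: hpt D - al *: hpt A.
  by rewrite -dg [RHS]addrC addKr.
split=> //.
- apply: contraNneq ABD => CBD; apply/eqP/(mulfI al0).
  have : hdet (hpt B) (hpt D) (al *: hpt A + ga *: hpt C) = 0.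
    by rewrite dg hdet_lin !hdet_alt; ring.
  by rewrite hdet_lin -!(hdet_rot _ (hpt B)) -/(orient C B D) CBD !mulr0 addr0.
- by rewrite addrC.
- by rewrite addrC dg.
- split; first by rewrite fa oppr_eq0.
  by rewrite fa scaleNr eF eC; move: (hpt A) (hpt B) (hpt D) => a b d;
    apply: rV3P; rewrite !mxE; ring.
- split; first by rewrite fe oppr_eq0.
  by rewrite fe scaleNr eE eC; move: (hpt A) (hpt B) (hpt D) => a b d;
    apply: rV3P; rewrite !mxE; ring.
- split; first by rewrite -opprB oppr_eq0.
  by rewrite -opprB scaleNr eR opprD addrC -!scaleNr opprK.
- by rewrite addrC [RHS]addrC.
Qed.

(** * The homology centers *)

Lemma scaler_solve (k : realFieldType) (x : k) (p q : 'rV[k]_3) :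
  x != 0 /\ x *: p = q -> p = x^-1 *: q.
Proof. by case=> x0 <-; rewrite scalerA mulVf // scale1r. Qed.

(** All points except C are written over the triangle ABD; in R the vertex C is
    eliminated by ga C = be B + de D - al A. *)
Lemma weighted_bary (k : realFieldType) (A B C D E F P R O : 'rV[k]_2)
    (al be ga de : k) (pt := bary (hpt A) (hpt B) (hpt D)) :
  weighted A B C D E F P R O al be ga de ->
  [/\ hpt E = pt (al / (al - be)) (- be / (al - be)) 0,
      hpt F = pt (al / (al - de)) 0 (- de / (al - de)),
      hpt P = pt 0 (be / (be - de)) (- de / (be - de)),
      hpt R = pt (2 * al / (al - ga)) (- be / (al - ga)) (- de / (al - ga))
    & hpt O = pt 0 (be / (al + ga)) (de / (al + ga))].
Proof.
case=> _ _ _ dg /scaler_solve -> /scaler_solve -> /scaler_solve ->.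
have -> : al *: hpt A + (- ga) *: hpt C =
    pt (2 * al) (- be) (- de).
  have -> : (- ga) *: hpt C = al *: hpt A - (be *: hpt B + de *: hpt D).
    by rewrite -dg opprD addrA subrr add0r scaleNr.
  rewrite /pt; move: (hpt A) (hpt B) (hpt D) => a b d.
  by apply: rV3P; rewrite !mxE; ring.
move=> /scaler_solve -> /scaler_solve ->; rewrite dg /pt.
move: (hpt A) (hpt B) (hpt D) => a b d.
by split; apply: rV3P; rewrite !mxE; ring.
Qed.

Lemma midpoints_bary (k : realFieldType) (A B C D E F P R O : 'rV[k]_2)
    (al be ga de : k) (pt := bary (hpt A) (hpt B) (hpt D)) :
  weighted A B C D E F P R O al be ga de ->
  [/\ hpt (midpoint A B) = pt 2^-1 2^-1 0,
      hpt (midpoint B F) =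
        pt (al / (2 * (al - de))) 2^-1 (- de / (2 * (al - de)))
    & hpt (midpoint A F) =
        pt ((2 * al - de) / (2 * (al - de))) 0 (- de / (2 * (al - de)))].
Proof.
move=> cfg; have [_ eF _ _ _] := weighted_bary cfg.
have [ade _] := meetF cfg.
have [[eA eB] _] := baryE (hpt A) (hpt B) (hpt D).
rewrite -/pt in eA eB eF.
have k2 : 2 != 0 :> k by rewrite pnatr_eq0.
split; rewrite hpt_midpoint.
- by rewrite eA eB bary_lin; congr bary; field.
- by rewrite eF eB bary_lin; congr bary; field; rewrite ?k2 ?ade.
- by rewrite eF eA bary_lin; congr bary; field; rewrite ?k2 ?ade.
Qed.

(** In a weighted configuration, with G, H, I the midpoints of AB, BF, AF and
    w = al + ga, this vector equals each of
      4 al be G - (al + ga)^2 O,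
      4 be (al - de) H - (be - de)^2 P,
      4 al (al - de) I - (al - ga)^2 R,
    so it lies on GO, HP and IR.  Its last coordinate may vanish: the three
    lines may be parallel. *)
Definition diag_center (k : realFieldType) (A B O : 'rV[k]_2) (al be w : k) :
    'rV[k]_3 :=
  (4 * al * be) *: hpt (midpoint A B) + (- w ^+ 2) *: hpt O.

(** Corresponding vertices differ because H and G are not on BD, which carries P
    and O, and R is not on AD, which carries I.  The incidences come from the
    triple expression of diag_center, checked through determinants. *)
Lemma homology_center_diag (k : realFieldType)
    (A B C D E F P R O : 'rV[k]_2) (al be ga de : k) :
  weighted A B C D E F P R O al be ga de ->
  homology_center (P, O, R) (midpoint B F, midpoint A B, midpoint A F)
    (diag_center A B O al be (al + ga)).
Proof.
move=> cfg; have [_ _ eP eR eO] := weighted_bary cfg.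
have [eG eH eI] := midpoints_bary cfg.
case: cfg => -[al0 be0 ga0 de0] ABD0 wE _.
move=> [abe _] [ade _] [bde _] [aga _] [w0 _].
have defga : ga = be + de - al by rewrite -wE; ring.
subst ga; move: eR eO w0 aga; rewrite wE => eR eO w0 aga.
have k2 : 2 != 0 :> k by rewrite pnatr_eq0.
pose pt := bary (hpt A) (hpt B) (hpt D).
have [[eA eB] eD] := baryE (hpt A) (hpt B) (hpt D).
rewrite -/pt in eA eB eD eP eR eO eG eH eI.
have eq_q : diag_center A B O al be (be + de) =
    pt (2 * al * be) (be * (2 * al - be - de)) (- de * (be + de)).
  by rewrite /diag_center eG eO bary_lin; congr bary; field; rewrite ?k2 ?w0.
move: (diag_center _ _ _ _ _ _) eq_q => q eq_q.
have nz c x1 y1 z1 x2 y2 z2 x3 y3 z3 :=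
  @hdet_bary_neq0 _ (hpt A) (hpt B) (hpt D) c x1 y1 z1 x2 y2 z2 x3 y3 z3 ABD0.
have z x1 y1 z1 x2 y2 z2 x3 y3 z3 :=
  @hdet_bary_eq0 _ (hpt A) (hpt B) (hpt D) x1 y1 z1 x2 y2 z2 x3 y3 z3.
rewrite -/pt in nz z; clearbody pt.
have inI (x : k) : x != 0 -> x^-1 != 0 by rewrite invr_eq0.
split.
- split; rewrite /nondegenerate /= /orient.
  + rewrite eP eO eR; apply: (nz (4 * al * be * de *
      ((be - de)^-1 * (be + de)^-1 * (al - (be + de - al))^-1))).
      by field; rewrite ?aga ?w0 ?bde.
    by rewrite !mulf_neq0 ?inI ?pnatr_eq0.
  + rewrite eG eH eI; apply: (nz (de / (4 * (al - de)))).
      by field; rewrite ?k2 ?ade.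
    by rewrite !mulf_neq0 ?oppr_eq0 ?inI ?mulf_neq0 ?pnatr_eq0.
- split.
  + apply: (@neq_on_line _ _ _ B D); rewrite /on_line /collinear.
      by rewrite eB eD eP; apply: z; field; rewrite ?bde.
    rewrite eB eD eH; apply: (nz (al / (2 * (al - de)))).
      by field; rewrite ?k2 ?ade.
    by rewrite !mulf_neq0 ?oppr_eq0 ?inI ?mulf_neq0 ?pnatr_eq0.
  + apply: (@neq_on_line _ _ _ B D); rewrite /on_line /collinear.
      by rewrite eB eD eO; apply: z; field; rewrite ?w0.
    rewrite eB eD eG; apply: (nz 2^-1); last by rewrite inI.
    by field.
  + rewrite eq_sym; apply: (@neq_on_line _ _ _ A D);
      rewrite /on_line /collinear.
      by rewrite eA eD eI; apply: z; field; rewrite ?k2 ?ade.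
    rewrite eA eD eR; apply: (nz (be / (al - (be + de - al)))).
      by field; rewrite ?aga.
    by rewrite mulf_neq0 ?inI.
- apply/eqP => q0.
  have /eqP[] : hdet (hpt B) (hpt D) q != 0.
    rewrite eB eD eq_q; apply: (nz (2 * al * be)); first by ring.
    by rewrite !mulf_neq0 ?pnatr_eq0.
  by rewrite q0 hdetE !mxE; ring.
rewrite eq_q /on_line /collinear eP eO eR eG eH eI.
split; apply: z; field; by rewrite ?k2 ?w0 ?ade ?bde ?aga.
Qed.

(** The homothety of center A and ratio 1/2 sends B, D, P to G, J, the center,
    and E, F, P to K, I, the center.  For HL the weighted identity
    be (al - de) H - de (al - be) L = al (be - de) mid(A, P) is what the
    determinant checks. *)
Lemma homology_center_mid (k : realFieldType)
    (A B C D E F P R O : 'rV[k]_2) (al be ga de : k) :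
  weighted A B C D E F P R O al be ga de ->
  homology_center (midpoint A B, midpoint B F, midpoint A F)
    (midpoint A D, midpoint D E, midpoint A E) (hpt (midpoint A P)).
Proof.
move=> cfg; have [_ _ eP _ _] := weighted_bary cfg.
have [eG eH eI] := midpoints_bary cfg.
have [eJ eL eK] := midpoints_bary (weighted_swapBD cfg).
rewrite baryC in eJ; rewrite baryC in eL; rewrite baryC in eK.
case: cfg => -[al0 be0 _ de0] ABD0 _ _ [abe _] [ade _] [bde _] _ _.
have k2 : 2 != 0 :> k by rewrite pnatr_eq0.
pose pt := bary (hpt A) (hpt B) (hpt D).
have [[eA eB] eD] := baryE (hpt A) (hpt B) (hpt D).
rewrite -/pt in eA eB eD eP eG eH eI eJ eL eK.
have eS : hpt (midpoint A P) =
    pt 2^-1 (be / (2 * (be - de))) (- de / (2 * (be - de))).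
  by rewrite hpt_midpoint eP eA bary_lin; congr bary; field; rewrite ?k2 ?bde.
have hd x1 y1 z1 x2 y2 z2 x3 y3 z3 :=
  @hdet_bary _ (hpt A) (hpt B) (hpt D) x1 y1 z1 x2 y2 z2 x3 y3 z3.
have nz c x1 y1 z1 x2 y2 z2 x3 y3 z3 :=
  @hdet_bary_neq0 _ (hpt A) (hpt B) (hpt D) c x1 y1 z1 x2 y2 z2 x3 y3 z3 ABD0.
have z x1 y1 z1 x2 y2 z2 x3 y3 z3 :=
  @hdet_bary_eq0 _ (hpt A) (hpt B) (hpt D) x1 y1 z1 x2 y2 z2 x3 y3 z3.
rewrite -/pt in hd nz z; clearbody pt.
have inI (x : k) : x != 0 -> x^-1 != 0 by rewrite invr_eq0.
split.
- split; rewrite /nondegenerate /= /orient.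
  + rewrite eG eH eI; apply: (nz (- de / (4 * (al - de)))).
      by field; rewrite ?k2 ?ade.
    by rewrite !mulf_neq0 ?oppr_eq0 ?inI ?mulf_neq0 ?pnatr_eq0.
  + rewrite eJ eL eK; apply: (nz (be / (4 * (al - be)))).
      by field; rewrite ?k2 ?abe.
    by rewrite !mulf_neq0 ?oppr_eq0 ?inI ?mulf_neq0 ?pnatr_eq0.
- split.
  + apply: (@neq_on_line _ _ _ A B); rewrite /on_line /collinear.
      by rewrite eA eB eG; apply: z; ring.
    by rewrite eA eB eJ; apply: (nz 2^-1); [ring | rewrite inI].
  (* The distances of H and L to AB, from their coordinates on D, differ. *)
  + apply/eqP => HL; have : hdet (hpt A) (hpt B) (hpt (midpoint B F)) =
      hdet (hpt A) (hpt B) (hpt (midpoint D E)) by rewrite HL.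
    rewrite eA eB eH eL !hd => /(mulIf ABD0) hz.
    have {}hz : - de / (2 * (al - de)) = 2^-1.
      by apply: etrans (etrans _ hz) _; ring.
    case/eqP: al0.
    have -> : al = 2 * (al - de) * (2^-1 - (- de / (2 * (al - de)))).
      by field; rewrite ?k2 ?ade.
    by rewrite hz subrr mulr0.
  + rewrite eq_sym; apply: (@neq_on_line _ _ _ A B);
      rewrite /on_line /collinear.
      by rewrite eA eB eK; apply: z; ring.
    rewrite eA eB eI; apply: (nz (- de / (2 * (al - de)))); first by ring.
    by rewrite !mulf_neq0 ?oppr_eq0 ?inI ?mulf_neq0.
- by apply/eqP => /rowP/(_ 2%:R)/eqP; rewrite hptE mxE oner_eq0.
rewrite /on_line /collinear eG eH eI eJ eL eK eS.
split; apply: z; field; by rewrite ?k2 ?abe ?ade ?bde.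
Qed.

(** The terms in O of the two centers cancel, and
    4 al be G - 4 al de J = 4 al (be - de) mid(A, P). *)
Lemma diag_center_swapBD (k : realFieldType) (A B C D E F P R O : 'rV[k]_2)
    (al be ga de : k) :
  weighted A B C D E F P R O al be ga de ->
  diag_center A B O al be (al + ga) =
  1 *: diag_center A D O al de (al + ga) +
    (4 * al * (be - de)) *: hpt (midpoint A P).
Proof.
move=> cfg; have [_ _ eP _ _] := weighted_bary cfg.
have [bde _] := meetP cfg.
rewrite /diag_center !hpt_midpoint eP.
move: (hpt A) (hpt B) (hpt D) (hpt O) => a b d o.
by apply: rV3P; rewrite !mxE; field; rewrite ?bde ?pnatr_eq0.
Qed.

(** By uniqueness the three centers are multiples of the explicit ones, which
    are dependent by the previous lemma. *)
Lemma centers_collinear (k : realFieldType)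
    (A B C D E F P R O : 'rV[k]_2) (al be ga de : k) (p q r : 'rV[k]_3) :
  weighted A B C D E F P R O al be ga de ->
  homology_center (midpoint A B, midpoint B F, midpoint A F)
    (midpoint A D, midpoint D E, midpoint A E) p ->
  homology_center (P, O, R) (midpoint B F, midpoint A B, midpoint A F) q ->
  homology_center (P, O, R) (midpoint D E, midpoint A D, midpoint A E) r ->
  collinear p q r.
Proof.
move=> cfg hp hq hr.
have [x ->] := homology_center_uniq hp (homology_center_mid cfg).
have [y ->] := homology_center_uniq hq (homology_center_diag cfg).
have [z ->] := homology_center_uniq hr
  (homology_center_diag (weighted_swapBD cfg)).
rewrite /collinear (diag_center_swapBD cfg).
move: (hpt (midpoint A P)) (diag_center A D O al de (al + ga)) => s c.
by rewrite !hdetE !mxE; apply/eqP; ring.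
Qed.

Lemma midpointC (k : realFieldType) (X Y : 'rV[k]_2) :
  midpoint X Y = midpoint Y X.
Proof. by rewrite /midpoint addrC. Qed.

Theorem mainTheorem2 (k : realFieldType)
    (A B C D E F P R O : 'rV[k]_2)
    (G H I J K L M N Q U V T : 'rV[k]_2)
    (hABCD : convex_quadrilateral A B C D)
    (hE : meet_at A B C D E) (hF : meet_at B C A D F)
    (hP : meet_at B D E F P) (hR : meet_at A C E F R)
    (hO : meet_at A C B D O)
    (hG : G = midpoint A B) (hH : H = midpoint B F) (hI : I = midpoint A F)
    (hJ : J = midpoint A D) (hK : K = midpoint A E) (hL : L = midpoint D E)
    (hM : M = midpoint C E) (hN : N = midpoint B E) (hQ : Q = midpoint B C)
    (hU : U = midpoint C F) (hV : V = midpoint D F) (hT : T = midpoint D C) :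
  [/\ (* i *)
      [/\ homological (P, O, R) (H, G, I), homological (P, O, R) (L, J, K),
          homological (P, O, R) (N, Q, M) & homological (P, O, R) (V, T, U)],
      (* ii *)
      affinely_homological (G, H, I) (J, L, K),
      (* iii *)
      affinely_homological (M, N, Q) (U, V, T),
      (* iv *)
      forall p q r : 'rV[k]_3,
        homology_center (G, H, I) (J, L, K) p ->
        homology_center (P, O, R) (H, G, I) q ->
        homology_center (P, O, R) (L, J, K) r ->
        collinear p q r
    & (* v *)
      forall p q r : 'rV[k]_3,
        homology_center (M, N, Q) (U, V, T) p ->
        homology_center (P, O, R) (N, Q, M) q ->
        homology_center (P, O, R) (V, T, U) r ->
        collinear p q r].
Proof.
have cfg := quadrilateral_weighted hABCD hE hF hP hR hO.
move: (orient _ _ _) (orient _ _ _) (orient _ _ _) (orient _ _ _) cfg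
  => al be ga de cfg.
have cfgC := weighted_swapAC cfg.
subst G H I J K L M N Q U V T.
(* Orders the midpoints as cfgC expects them. *)
rewrite (midpointC B C) (midpointC D C).
split.
- split; eexists.
  + exact: homology_center_diag cfg.
  + exact: homology_center_diag (weighted_swapBD cfg).
  + exact: homology_center_diag cfgC.
  + exact: homology_center_diag (weighted_swapBD cfgC).
- by exists (midpoint A P); exact: homology_center_mid cfg.
- exists (midpoint C P); apply: homology_center_rev.
  exact: homology_center_mid cfgC.
- by move=> p q r; exact: centers_collinear cfg.
by move=> p q r /homology_center_rev; exact: centers_collinear cfgC.
Qed.
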